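(* Let $Q$ be a (discrete) group, let $P$ be a submonoid of $Q$, and let $(X,P,T_X)$ and $(Y,P,T_Y)$ be locally compact and directed (partial) monoid actions, with semidirect product groupoids $G_X$ and $G_Y$. If $h\colon X\to Y$ is a conjugacy, then $$\psi_h\colon G_X\to G_Y,\qquad \psi_h((x,q,y)) := (h(x),q,h(y)),$$ is an isomorphism of topological groupoids such that, for all open $U,V\subseteq X$ and all $m,n\in P$, $\psi_h(Z_X(U,m,n,V)) = Z_Y(h(U),m,n,h(V))$. Moreover, for each closed invariant $U\subseteq X$, the set $h(U)\subseteq Y$ is closed and invariant, and $\psi_h$ restricts to an isomorphism of topological groupoids from the reduction $G_X|_U$ to the reduction $G_Y|_{h(U)}$.
   Context: Monoid actions. Let $X$ be a set and $P$ a monoid with identity $e$. A (partial) monoid action $(X,P,T_X)$ of $P$ on $X$ consists of a subset $X*P\subseteq X\times P$ and a function $T_X\colon X*P\to X$, $(x,m)\mapsto x\cdot m$, such that (S1) for all $x\in X$, $(x,e)\in X*P$ and $x\cdot e=x$; (S2) for all $(x,m,n)\in X\times P\times P$, $(x,mn)\in X*P$ if and only if $(x,m)\in X*P$ and $(x\cdot m,n)\in X*P$, in which case $(x\cdot m)\cdot n=x\cdot(mn)$. For $m\in P$ write $\mathrm{dom}_X(m)=\{x\in X : (x,m)\in X*P\}$, $\mathrm{im}_X(m)=\{x\cdot m : x\in \mathrm{dom}_X(m)\}$ and $T_X^m\colon \mathrm{dom}_X(m)\to\mathrm{im}_X(m)$, $x\mapsto x\cdot m$. Writing $x\cdot m$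 always implies $x\in\mathrm{dom}_X(m)$. For $p,r\in P$ write $p\le r$ if $pq=r$ for some $q\in P$. The action is directed if, for all $m,n\in P$, $\mathrm{dom}_X(m)\cap\mathrm{dom}_X(n)\ne\emptyset$ implies that there is $l\in P$ with $m,n\le l$ and $\mathrm{dom}_X(m)\cap\mathrm{dom}_X(n)\subseteq\mathrm{dom}_X(l)$. The action is locally compact if $X$ is a locally compact Hausdorff space and, for all $m\in P$, $\mathrm{dom}_X(m)$ and $\mathrm{im}_X(m)$ are open in $X$ and $T_X^m$ is a local homeomorphism. A subset $U\subseteq X$ is invariant (with respect to $T_X$) if, for all $x\in X$, $y\in U$ and $m,n\in P$, $x\cdot m=y\cdot n$ implies $x\in U$. Conjugacy. For monoid actions $(X,P,T_X)$, $(Y,P,T_Y)$ on topological spaces, a conjugacy is a map $h\colon X\to Y$ such that (C1) $h$ is a homeomorphism; (C2) $h(\mathrm{dom}_X(m))=\mathrm{dom}_Y(m)$ for all $m\in P$; (C3) $h(x\cdot m)=h(x)\cdot m$ for all $m\in P$ and $x\in\mathrm{dom}_X(m)$. Semidirect product groupoid. For a directed and locally compact monoid action $(X,P,T_X)$ with $P$ a submonoid of a discrete group $Q$, $G_X$ is the set of $(x,q,y)\in X\times Q\times X$ for which there are $m,n\in P$ with $q=mn^{-1}$, $x\in\mathrm{dom}_X(m)$, $y\in\mathrm{dom}_X(n)$ and $x\cdot m=y\cdot n$. Two elements $(x,q,y),(w,r,z)$ are composable iff $y=w$, with composition $(x,q,y)(y,r,z)=(x,qr,z)$, and inversion is $(x,q,y)^{-1}=(y,q^{-1},x)$.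 The sets $Z_X(U,m,n,V)=\{(x,mn^{-1},y)\in G_X : x\in U,\ y\in V,\ x\cdot m=y\cdot n\}$, for $m,n\in P$ and $U,V\subseteq X$ open, form a basis for the topology of $G_X$, making it an étale locally compact Hausdorff groupoid. The unit space of $G_X$ is identified with $X$ via $x\mapsto (x,e,x)$. For $U\subseteq X$, the reduction is $G_X|_U=\{(x,q,y)\in G_X : x,y\in U\}$, with the subspace topology. An isomorphism of topological groupoids is a homeomorphism that preserves and reflects composability and preserves composition and inversion. *)

(* Defs.v *)
From HB Require Import structures.
From mathcomp Require Import all_boot.
From mathcomp Require Import all_classical.
From mathcomp Require Import topology.

Set Implicit Arguments.
Unset Strict Implicit.
Unset Printing Implicit Defensive.

Local Open Scope classical_set_scope.
Local Open Scope group_scope.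

(* Subsets, coerced to types, carry the subspace topology (subtype_topology.v). *)

Definition corestrict (S T : Type) (f : S -> T) (A : set S) : A -> f @` A :=
  fun x => SigSub (mem_set (imageP f (set_valP x))).

Definition homeomorphism (S T : topologicalType) (f : S -> T) :=
  exists g : T -> S, [/\ cancel f g, cancel g f, continuous f & continuous g].

Definition local_homeomorphism (S T : topologicalType) (f : S -> T) :=
  forall x : S, exists U : set S,
    [/\ open U, U x, open (f @` U) & homeomorphism (@corestrict S T f U)].

(* The partial map T_X is represented by its domain [actD], the set X * P, and
   a total function [act] whose values outside [actD] are never used: every
   notion below that mentions [act x m] also requires [actD (x, m)]. *)
Record monoid_action (X : Type) (P : monoidType) := MonoidAction {
  actD : set (X * P);
  act : X -> P -> X;
  act1 : forall x, actD (x, 1) /\ act x 1 = x;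
  actMD : forall x m n,
    actD (x, m * n) <-> actD (x, m) /\ actD (act x m, n);
  actM : forall x m n, actD (x, m * n) -> act (act x m) n = act x (m * n)
}.

Definition prefix_le (P : monoidType) (p r : P) := exists q, p * q = r.

Section Action.
Context (X : Type) (P : monoidType) (T : monoid_action X P).

Definition dom (m : P) : set X := [set x | actD T (x, m)].
Definition im (m : P) : set X := (act T)^~ m @` dom m.
Definition act_map (m : P) : dom m -> im m := @corestrict X X ((act T)^~ m) (dom m).

Definition directed := forall m n : P, dom m `&` dom n !=set0 ->
  exists l, [/\ prefix_le m l, prefix_le n l & dom m `&` dom n `<=` dom l].

Definition act_invariant (U : set X) := forall x y (m n : P), U y ->
  dom m x -> dom n y -> act T x m = act T y n -> U x.

End Action.

Definition locally_compact_action (X : topologicalType) (P : monoidType)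
    (T : monoid_action X P) :=
  [/\ hausdorff_space X, locally_compact [set: X] &
      forall m, [/\ open (dom T m), open (im T m) &
                    local_homeomorphism (@act_map X P T m)]].

Definition conjugacy (X Y : topologicalType) (P : monoidType)
    (TX : monoid_action X P) (TY : monoid_action Y P) (h : X -> Y) :=
  [/\ homeomorphism h,
      forall m, h @` dom TX m = dom TY m &
      forall m x, dom TX m x -> h (act TX x m) = act TY (h x) m].

Record topGroupoid := TopGroupoid {
  gpd :> topologicalType;
  composable : gpd -> gpd -> Prop;
  gcomp : forall g h : gpd, composable g h -> gpd;
  ginv : gpd -> gpd;
  gcompA : forall g h k (gh : composable g h) (hk : composable h k),
    exists (ghk : composable (gcomp gh) k) (g_hk : composable g (gcomp hk)),
      gcomp ghk = gcomp g_hk;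
  ginvK : involutive ginv;
  composableV : forall g, composable g (ginv g);
  gcompKl : forall g h (gh : composable g h),
    exists vgh : composable (ginv g) (gcomp gh), gcomp vgh = h;
  gcompKr : forall g h (gh : composable g h),
    exists ghv : composable (gcomp gh) (ginv h), gcomp ghv = g;
  gcomp_continuous : continuous
    (fun p : [set gh : gpd * gpd | composable gh.1 gh.2] => gcomp (set_valP p));
  ginv_continuous : continuous ginv
}.
Arguments composable {t}.
Arguments gcomp {t g h}.
Arguments ginv {t}.

Record groupoid_iso (G H : topGroupoid) (f : G -> H) : Prop := GroupoidIso {
  iso_homeo : homeomorphism f;
  iso_composable : forall g h, composable (f g) (f h) <-> composable g h;
  iso_comp : forall g h (gh : composable g h) (fgh : composable (f g) (f h)),
    f (gcomp gh) = gcomp fgh;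
  iso_inv : forall g, f (ginv g) = ginv (f g)
}.

Section Subgroupoid.
Context (G : topGroupoid) (A : set G).
Hypothesis Acomp : forall g h (gh : composable g h), A g -> A h -> A (gcomp gh).
Hypothesis Ainv : forall g, A g -> A (ginv g).

Let scomposable (g h : A) := composable (\val g) (\val h).
Let scomp (g h : A) (gh : scomposable g h) : A :=
  SigSub (mem_set (Acomp gh (set_valP g) (set_valP h))).
Let sinv (g : A) : A := SigSub (mem_set (Ainv (set_valP g))).

Let to_sub_continuous (S : topologicalType) (f : S -> A) :
  continuous (\val \o f) -> continuous f.
Proof.
move=> /continuousP fc; apply/continuousP => _ [B oB <-].
exact: (fc _ oB).
Qed.

Let val_continuous : continuous (\val : A -> G).
Proof. exact: initial_continuous. Qed.

Let scompA g h k (gh : scomposable g h) (hk : scomposable h k) :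
  exists (ghk : scomposable (scomp gh) k) (g_hk : scomposable g (scomp hk)),
    scomp ghk = scomp g_hk.
Proof.
have [a [b e]] := gcompA gh hk.
by exists a, b; apply: val_inj.
Qed.

Let sinvK : involutive sinv.
Proof. by move=> g; apply: val_inj; rewrite /= ginvK. Qed.

Let scompKl g h (gh : scomposable g h) :
  exists vgh : scomposable (sinv g) (scomp gh), scomp vgh = h.
Proof. by have [a e] := gcompKl gh; exists a; apply: val_inj. Qed.

Let scompKr g h (gh : scomposable g h) :
  exists ghv : scomposable (scomp gh) (sinv h), scomp ghv = g.
Proof. by have [a e] := gcompKr gh; exists a; apply: val_inj. Qed.

Let scomp_continuous : continuous
  (fun p : [set gh : A * A | scomposable gh.1 gh.2] => scomp (set_valP p)).
Proof.
apply: to_sub_continuous.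
set D := [set gh : G * G | composable gh.1 gh.2].
pose j (p : [set gh : A * A | scomposable gh.1 gh.2]) : D :=
  SigSub (@mem_set _ D (\val (\val p).1, \val (\val p).2) (set_valP p)).
have jc : continuous j.
  suff jc : continuous (\val \o j).
    by move/continuousP: jc => jc; apply/continuousP => _ [B oB <-]; exact: jc.
  pose B := [set gh : A * A | scomposable gh.1 gh.2].
  have vc : continuous (\val : B -> A * A) by exact: initial_continuous.
  have v1 : continuous (\val \o (fst \o (\val : B -> A * A))).
    move=> p; apply: continuous_comp; last exact: val_continuous.
    by apply: continuous_comp; [exact: vc|exact: cvg_fst].
  have v2 : continuous (\val \o (snd \o (\val : B -> A * A))).
    move=> p; apply: continuous_comp; last exact: val_continuous.
    by apply: continuous_comp; [exact: vc|exact: cvg_snd].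
  move=> p.
  exact: cvg_pair (v1 p) (v2 p).
have E : \val \o (fun p : [set gh : A * A | scomposable gh.1 gh.2] =>
    scomp (set_valP p)) = (fun p : D => gcomp (set_valP p)) \o j.
  apply/funext => p /=; congr (gcomp _); exact: Prop_irrelevance.
rewrite E => p; apply: continuous_comp; first exact: jc.
exact: gcomp_continuous.
Qed.

Let sinv_continuous : continuous sinv.
Proof.
have c : continuous (ginv \o (\val : A -> G)).
  move=> g; apply: continuous_comp; first exact: val_continuous.
  exact: ginv_continuous.
apply: to_sub_continuous => g; exact: c.
Qed.

Definition subgroupoid : topGroupoid :=
  @TopGroupoid A scomposable scomp sinv scompA sinvK
    (fun g => composableV (\val g)) scompKl scompKr scomp_continuous
    sinv_continuous.

End Subgroupoid.

(* [P : subMonoidType S] is the submonoid of [Q] with underlying subset [S], and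
   [val : P -> Q] is its inclusion. *)
Section SemidirectProduct.
Context (Q : groupType) (S : pred Q) (P : subMonoidType S).
Context (X : topologicalType) (T : monoid_action X P).

Definition sdp_set : set (X * Q * X) :=
  [set g | exists m n : P, [/\ g.1.2 = val m / val n,
     dom T m g.1.1, dom T n g.2 & act T g.1.1 m = act T g.2 n]].

Hypotheses (dirT : directed T) (lcT : locally_compact_action T).

(* The hypotheses are arguments so that the topology, which needs them, can be
   attached to this type. *)
Definition sdp of directed T & locally_compact_action T : Type :=
  set_type sdp_set.

Local Notation G := (sdp dirT lcT).

HB.instance Definition _ := Choice.copy G (set_type sdp_set).

Definition sdp_val (g : G) : X * Q * X := \val g.
Definition sdp_lft (g : G) : X := (sdp_val g).1.1.
Definition sdp_deg (g : G) : Q := (sdp_val g).1.2.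
Definition sdp_rgt (g : G) : X := (sdp_val g).2.

Lemma sdpP (g : G) : exists m n : P, [/\ sdp_deg g = val m / val n,
  dom T m (sdp_lft g), dom T n (sdp_rgt g) &
  act T (sdp_lft g) m = act T (sdp_rgt g) n].
Proof. exact: (set_valP g). Qed.

Definition sdp_Z (U : set X) (m n : P) (V : set X) : set G :=
  [set g | [/\ sdp_deg g = val m / val n, U (sdp_lft g), V (sdp_rgt g) &
     [/\ dom T m (sdp_lft g), dom T n (sdp_rgt g) &
         act T (sdp_lft g) m = act T (sdp_rgt g) n]]].

Definition sdp_base : set (set G) :=
  [set Z | exists U m n V, [/\ open U, open V & Z = sdp_Z U m n V]].

Lemma act_local m x (W : set X) : dom T m x -> open W -> W (act T x m) ->
  exists O : set X, [/\ open O, O x, O `<=` dom T m,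
    forall z, O z -> W (act T z m) &
    forall z z', O z -> O z' -> act T z m = act T z' m -> z = z'].
Proof.
move=> dx oW Wx; have [_ _ /(_ m)[od _ lh]] := lcT.
pose x' : dom T m := SigSub (mem_set dx).
have [U [oU Ux oTU [g [fK gK fc gc]]]] := lh x'.
have := fc; move/continuousP.
move=> /(_ (\val @^-1` (\val @^-1` W))) [].
  by exists (\val @^-1` W) => //; exists W.
move=> B oB BE.
have [O1 oO1 O1E] := oB; have [O2 oO2 O2E] := oU.
exists (O1 `&` O2 `&` dom T m).
have inU z (dz : dom T m z) : O2 z -> U (SigSub (mem_set dz)).
  by move=> O2z; rewrite -O2E.
have WE z (dz : dom T m z) (Uz : U (SigSub (mem_set dz))) :
    O1 z <-> W (act T z m).
  have := congr1 (fun A => A (SigSub (mem_set Uz))) BE.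
  rewrite /preimage /= => <-.
  have := congr1 (fun A => A (SigSub (mem_set dz))) O1E.
  by rewrite /preimage /= => <-.
split => //.
- by apply: openI => //; apply: openI.
- split=> //; split; last by move: Ux; rewrite -O2E.
  by apply/(WE x dx) => //.
- by move=> z [[O1z O2z] dz]; apply/(WE z dz) => //; apply: inU.
- move=> z z' [[_ O2z] dz] [[_ O2z'] dz'] e.
  have /(congr1 (fun u : U => \val (\val u))) // :
    (SigSub (mem_set (inU z dz O2z)) : U) = SigSub (mem_set (inU z' dz' O2z')).
  by apply: (can_inj fK); apply: val_inj; apply: val_inj.
Qed.

Lemma domM m p x :
  dom T (m * p) x <-> dom T m x /\ dom T p (act T x m).
Proof. exact: actMD. Qed.

Lemma sdp_refine (g : G) U m n V p : open U -> open V -> sdp_Z U m n V g ->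
  dom T (m * p) (sdp_lft g) ->
  exists U' V', [/\ open U', open V', sdp_Z U' (m * p) (n * p) V' g &
    sdp_Z U' (m * p) (n * p) V' `<=` sdp_Z U m n V].
Proof.
move=> oU oV [dg Ug Vg [dm dn e]] dmp.
have /domM[_ dp] := dmp.
have dnp : dom T (n * p) (sdp_rgt g).
  by apply/domM; split=> //; rewrite -e.
have [W [oW Wx Wd _ Winj]] := act_local dp openT I.
have [U1 [oU1 U1x U1d U1W _]] := act_local dm oW Wx.
have Wy : W (act T (sdp_rgt g) n) by rewrite -e.
have [V1 [oV1 V1x V1d V1W _]] := act_local dn oW Wy.
exists (U `&` U1), (V `&` V1); split; [exact: openI|exact: openI| |].
  split => //.
    by rewrite dg !valM mulgKA.
  by split=> //; rewrite -actM // e actM.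
move=> k [dk [Uk U1k] [Vk V1k] [dmk dnk ek]].
have dm' := U1d _ U1k; have dn' := V1d _ V1k.
split => //; first by rewrite dk !valM mulgKA.
split=> //; apply: Winj; [exact: U1W|exact: V1W|].
by rewrite !actM.
Qed.

Lemma sdp_cover : \bigcup_(Z in sdp_base) id Z = [set: G].
Proof.
apply/seteqP; split=> // g _.
have [m [n [dg dm dn e]]] := sdpP g.
exists (sdp_Z setT m n setT) => //.
by exists setT, m, n, setT; split=> //; exact: openT.
Qed.

Lemma sdp_join (Z1 Z2 : set G) g : sdp_base Z1 -> sdp_base Z2 -> id Z1 g ->
  id Z2 g ->
  exists Z, [/\ sdp_base Z, id Z g & id Z `<=` id Z1 `&` id Z2].
Proof.
move=> [U [m [n [V [oU oV ->]]]]] [U' [m' [n' [V' [oU' oV' ->]]]]] /= Zg Z'g.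
have [dg _ _ [dm dn e]] := Zg; have [dg' _ _ [dm' dn' e']] := Z'g.
have [l [[p ep] [p' ep'] dl]] := dirT (ex_intro _ _ (conj dm dm')).
have lx : dom T l (sdp_lft g) by apply: dl.
have enp : n' * p' = n * p.
  apply: val_inj; rewrite !valM.
  have -> : val n' = (sdp_deg g)^-1 * val m' by rewrite dg' invgF mulgVK.
  have -> : val n = (sdp_deg g)^-1 * val m by rewrite dg invgF mulgVK.
  by rewrite -!mulgA -!valM ep ep'.
have [|U1 [V1 [oU1 oV1 Z1g Z1s]]] := sdp_refine oU oV Zg (p := p).
  by rewrite ep.
have [|U2 [V2 [oU2 oV2 Z2g Z2s]]] := sdp_refine oU' oV' Z'g (p := p').
  by rewrite ep'.
rewrite ep in Z1g Z1s; rewrite ep' enp in Z2g Z2s.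
exists (sdp_Z (U1 `&` U2) l (n * p) (V1 `&` V2)); split.
- by exists (U1 `&` U2), l, (n * p), (V1 `&` V2); split=> //; exact: openI.
- by case: Z1g => ? ? ? ?; case: Z2g => ? ? ? ?; split.
- by move=> k [? [? ?] [? ?] ?]; split; [apply: Z1s|apply: Z2s].
Qed.

HB.instance Definition _ :=
  @isBaseTopological.Build G (set G) sdp_base id sdp_cover sdp_join.

Lemma sdp_Z_open U m n V : open U -> open V -> open (sdp_Z U m n V).
Proof.
move=> oU oV; exists [set sdp_Z U m n V]; last by rewrite bigcup_set1.
by move=> _ ->; exists U, m, n, V.
Qed.

Lemma sdp_nbhsP (g : G) (A : set G) : nbhs g A ->
  exists U m n V, [/\ open U, open V, sdp_Z U m n V g & sdp_Z U m n V `<=` A].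
Proof.
rewrite nbhsE => -[_ [[D sD <-] [Z DZ Zg]] BA].
have [U [m [n [V [oU oV E]]]]] := sD _ DZ.
exists U, m, n, V; split=> //; first by rewrite -E.
by apply: subset_trans BA; rewrite -E => k Zk; exists Z.
Qed.

Definition sdp_composable (g h : G) : Prop := sdp_rgt g = sdp_lft h.

Lemma sdp_comp_rep (g h : G) : sdp_composable g h ->
  forall l0, dom T l0 (sdp_lft g) ->
  exists a b d q, [/\ a = l0 * q,
    sdp_Z setT a b setT g, sdp_Z setT b d setT h &
    [/\ sdp_deg g * sdp_deg h = val a / val d, dom T a (sdp_lft g),
        dom T d (sdp_rgt h) & act T (sdp_lft g) a = act T (sdp_rgt h) d]].
Proof.
move=> gh l0 dl0.
have [a [b [dg da db eg]]] := sdpP g.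
have [c [d [dh dc dd eh]]] := sdpP h.
rewrite -gh in dc eh.
have [l [[p ep] [p' ep'] dl]] := dirT (ex_intro _ _ (conj db dc)).
have dly : dom T l (sdp_rgt g) by apply: dl.
have dap : dom T (a * p) (sdp_lft g).
  by apply/domM; split=> //; rewrite eg; move: dly; rewrite -ep => /domM[].
have [s [[p2 ep2] [q eq0] ds]] := dirT (ex_intro _ _ (conj dap dl0)).
have dsx : dom T (a * (p * p2)) (sdp_lft g) by rewrite mulgA ep2; apply: ds.
have dbx : dom T (b * (p * p2)) (sdp_rgt g).
  by apply/domM; split=> //; rewrite -eg; move: dsx => /domM[].
have E : b * (p * p2) = c * (p' * p2) by rewrite !mulgA ep ep'.
have dcx : dom T (c * (p' * p2)) (sdp_rgt g) by rewrite -E.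
have ddx : dom T (d * (p' * p2)) (sdp_rgt h).
  by apply/domM; split=> //; rewrite -eh; move: dcx => /domM[].
have e1 : act T (sdp_lft g) (a * (p * p2)) = act T (sdp_rgt g) (b * (p * p2)).
  by rewrite -actM // eg actM.
have e2 : act T (sdp_rgt g) (b * (p * p2)) = act T (sdp_rgt h) (d * (p' * p2)).
  by rewrite E -actM // eh actM.
have dg2 : sdp_deg g = val (a * (p * p2)) / val (b * (p * p2)).
  by rewrite dg !valM mulgKA.
have dh2 : sdp_deg h = val (b * (p * p2)) / val (d * (p' * p2)).
  by rewrite E dh !(valM _ (p' * p2)) mulgKA.
exists (a * (p * p2)), (b * (p * p2)), (d * (p' * p2)), q; split.
- by rewrite mulgA ep2 -eq0.
- by [].
- by split=> //; rewrite -gh.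
- by split=> //; [rewrite dg2 dh2 mulgA mulgVK|rewrite e1].
Qed.

Lemma sdp_comp_proof (g h : G) : sdp_composable g h ->
  sdp_set (sdp_lft g, sdp_deg g * sdp_deg h, sdp_rgt h).
Proof.
move=> gh; have [d1 _] := act1 T (sdp_lft g).
have [a [b [d [q [_ _ _ [? ? ? ?]]]]]] := sdp_comp_rep gh d1.
by exists a, d.
Qed.

Definition sdp_comp (g h : G) (gh : sdp_composable g h) : G :=
  SigSub (mem_set (sdp_comp_proof gh)).

Lemma sdp_inv_proof (g : G) : sdp_set (sdp_rgt g, (sdp_deg g)^-1, sdp_lft g).
Proof.
have [m [n [dg dm dn e]]] := sdpP g.
by exists n, m; split=> //=; rewrite dg invgF.
Qed.

Definition sdp_inv (g : G) : G := SigSub (mem_set (sdp_inv_proof g)).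

Lemma sdp_eq (g h : G) : sdp_lft g = sdp_lft h -> sdp_deg g = sdp_deg h ->
  sdp_rgt g = sdp_rgt h -> g = h.
Proof.
move=> e1 e2 e3; apply: val_inj; rewrite -/(sdp_val g) -/(sdp_val h).
move: e1 e2 e3; rewrite /sdp_lft /sdp_deg /sdp_rgt.
by case: (sdp_val g) => [[? ?] ?]; case: (sdp_val h) => [[? ?] ?] /= -> -> ->.
Qed.

Lemma sdp_compA g h k (gh : sdp_composable g h) (hk : sdp_composable h k) :
  exists (ghk : sdp_composable (sdp_comp gh) k)
         (g_hk : sdp_composable g (sdp_comp hk)),
    sdp_comp ghk = sdp_comp g_hk.
Proof.
exists hk, gh; apply: sdp_eq => //=.
by rewrite /sdp_deg /= /sdp_deg mulgA.
Qed.

Lemma sdp_invK : involutive sdp_inv.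
Proof. by move=> g; apply: sdp_eq => //; rewrite /sdp_deg /= invgK. Qed.

Lemma sdp_composableV g : sdp_composable g (sdp_inv g).
Proof. by []. Qed.

Lemma sdp_compKl g h (gh : sdp_composable g h) :
  exists vgh : sdp_composable (sdp_inv g) (sdp_comp gh), sdp_comp vgh = h.
Proof. by exists erefl; apply: sdp_eq => //; rewrite /sdp_deg /= mulKg. Qed.

Lemma sdp_compKr g h (gh : sdp_composable g h) :
  exists ghv : sdp_composable (sdp_comp gh) (sdp_inv h), sdp_comp ghv = g.
Proof. by exists erefl; apply: sdp_eq => //; rewrite /sdp_deg /= mulgK. Qed.

Lemma sdp_comp_continuous : continuous
  (fun p : [set gh : G * G | sdp_composable gh.1 gh.2] =>
     sdp_comp (set_valP p)).
Proof.
move=> p A /sdp_nbhsP[U [m [n [V [oU oV Zp ZA]]]]].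
rewrite nbhs_filterE.
have gh := set_valP p; move: Zp.
set k := sdp_comp _ => Zk.
have lk : sdp_lft k = sdp_lft (\val p).1 by [].
have rk : sdp_rgt k = sdp_rgt (\val p).2 by [].
have dk : sdp_deg k = sdp_deg (\val p).1 * sdp_deg (\val p).2 by [].
have [dkm _ _ [dm dn e]] := Zk.
have dm1 : dom T m (sdp_lft (\val p).1) by rewrite -lk.
have [a [b [d [q [ea Zg Zh [dgh da dd ead]]]]]] := sdp_comp_rep gh dm1.
have [|U' [V' [oU' oV' Z'k Z's]]] := sdp_refine oU oV Zk (p := q).
  by rewrite -ea lk.
have ed : d = n * q.
  apply: val_inj; case: Z'k; rewrite dk dgh -ea => /mulgI/invg_inj -> //.
rewrite -ea -ed in Z'k Z's.
have : nbhs (\val p) (sdp_Z U' a b setT `*` sdp_Z setT b d V').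
  exists (sdp_Z U' a b setT, sdp_Z setT b d V') => //; split=> /=.
    apply: open_nbhs_nbhs; split; first exact: sdp_Z_open openT.
    by case: Zg => ? _ _ ?; case: Z'k => _ + _ _; rewrite lk; split.
  apply: open_nbhs_nbhs; split; first exact: sdp_Z_open openT _.
  by case: Zh => ? _ _ ?; case: Z'k => _ _ + _; rewrite rk; split.
set W := _ `*` _ => NW.
have {}NW : nbhs p (\val @^-1` W) by exact: initial_continuous NW.
apply: (@filterS _ _ (nbhs_filter p) _ _ _ NW) => r /= [[dg1 Ug _ [da1 db1 e1]] [dh1 _ Vh [db2 dd2 e2]]].
apply/ZA/Z's; have rgh := set_valP r.
have rgh' : sdp_rgt (\val r).1 = sdp_lft (\val r).2 := rgh.
split=> //.
  rewrite [LHS](_ : _ = sdp_deg (\val r).1 * sdp_deg (\val r).2) //.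
  by rewrite dg1 dh1 mulgA mulgVK.
split=> //; transitivity (act T (sdp_rgt (\val r).1) b) => //.
by rewrite rgh'.
Qed.

Lemma sdp_inv_continuous : continuous sdp_inv.
Proof.
move=> g A /sdp_nbhsP[U [m [n [V [oU oV Zg ZA]]]]]; rewrite nbhs_filterE.
have ZE k : sdp_Z U m n V (sdp_inv k) <-> sdp_Z V n m U k.
  have E : (sdp_deg (sdp_inv k) = val m / val n) <->
           (sdp_deg k = val n / val m).
    rewrite /sdp_deg /= -/(sdp_deg k); split=> [|->]; last by rewrite invgF.
    by move=> /(congr1 (fun x => x^-1)); rewrite invgK invgF.
  by split=> -[/E ? ? ? [? ? ?]]; split.
suff : nbhs g (sdp_Z V n m U).
  by apply: (@filterS _ _ (nbhs_filter g)) => k /ZE/ZA.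
by apply: open_nbhs_nbhs; split; [exact: sdp_Z_open|apply/ZE].
Qed.

Definition semidirect_groupoid : topGroupoid :=
  @TopGroupoid G sdp_composable sdp_comp sdp_inv sdp_compA sdp_invK
    sdp_composableV sdp_compKl sdp_compKr sdp_comp_continuous
    sdp_inv_continuous.

Definition reduction_set (U : set X) : set semidirect_groupoid :=
  [set g | U (sdp_lft g) /\ U (sdp_rgt g)].

Lemma reduction_comp U (g h : semidirect_groupoid) (gh : composable g h) :
  reduction_set U g -> reduction_set U h -> reduction_set U (gcomp gh).
Proof. by move=> [Ug _] [_ Uh]. Qed.

Lemma reduction_inv U (g : semidirect_groupoid) :
  reduction_set U g -> reduction_set U (ginv g).
Proof. by case. Qed.

Definition reduction (U : set X) : topGroupoid :=
  subgroupoid (@reduction_comp U) (@reduction_inv U).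

End SemidirectProduct.

(* Main.v *)
Require Import Defs.
From mathcomp Require Import all_boot.
From mathcomp Require Import all_classical.
From mathcomp Require Import topology.

Set Implicit Arguments.
Unset Strict Implicit.
Unset Printing Implicit Defensive.

Local Open Scope classical_set_scope.

(** Everything is transported along [h]: membership in [dom m] and the equation
    [x . m = y . n] are both preserved and reflected by a conjugacy, so the
    preimage of [Z_Y(U, m, n, V)] under [psi_h] is
    [Z_X(h^-1(U), m, n, h^-1(V))] and [psi_h] is continuous.  Since [h^-1] is
    again a conjugacy, [psi_(h^-1)] is a continuous inverse of [psi_h]. *)

Lemma set_type_continuous (S T : topologicalType) (A : set T) (f : S -> A) :
  continuous (set_val \o f) -> continuous f.
Proof.
move=> /continuousP fc; apply/continuousP => _ [B oB <-].
exact: (fc _ oB).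
Qed.

Lemma set_val_continuous (T : topologicalType) (A : set T) :
  continuous (set_val : A -> T).
Proof. exact: initial_continuous. Qed.

(** The inclusion proof [AB] is an argument so that one construction serves both for psi_h, as a map
    between subtypes of triples, and for restrictions to subgroupoids. *)
Definition set_type_map (S T : Type) (A : set S) (B : set T) (f : S -> T)
    (AB : forall x, A x -> B (f x)) (x : A) : B :=
  SigSub (mem_set (AB _ (set_valP x))).

Lemma set_type_map_continuous (S T : topologicalType) (A : set S) (B : set T)
    (f : S -> T) (AB : forall x, A x -> B (f x)) :
  continuous f -> continuous (set_type_map AB).
Proof.
move=> fc; apply: set_type_continuous => x.
exact: continuous_comp (@set_val_continuous _ A x) (fc _).
Qed.

(** The inverse [g] sends [B] into [A] because [f (g y) = y] and [f] reflects membership; so [f] and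
    [g] restrict to mutually inverse continuous maps. *)
Lemma homeomorphism_set_type_map (S T : topologicalType) (A : set S)
    (B : set T) (f : S -> T) (AB : forall x, A x -> B (f x)) :
  homeomorphism f -> (forall x, B (f x) -> A x) ->
  homeomorphism (set_type_map AB).
Proof.
move=> [g [fK gK fc gc]] BA.
have {}BA y : B y -> A (g y) by move=> By; apply: BA; rewrite gK.
exists (set_type_map BA); split; [| |exact: set_type_map_continuous..].
- by move=> x; apply: val_inj; apply: fK.
- by move=> y; apply: val_inj; apply: gK.
Qed.

(** The image under [f] is the preimage under its continuous inverse. *)
Lemma homeomorphism_closed_image (S T : topologicalType) (f : S -> T)
    (A : set S) :
  homeomorphism f -> closed A -> closed (f @` A).
Proof.
move=> [g [fK gK _ gc]] cA; rewrite (_ : f @` A = g @^-1` A).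
  by apply: preimage_closed => // x _; exact: gc.
apply/seteqP; split=> [_ [x Ax <-]|y Ay]; first by rewrite /preimage /= fK.
by exists (g y).
Qed.

(** Composability, composition and inversion in a subgroupoid are computed in the ambient one, so
    [phi] inherits these clauses from [f]; that [f] also reflects membership makes [phi] onto. *)
Lemma subgroupoid_iso (G H : topGroupoid) (f : G -> H) (A : set G) (B : set H)
    (Ac : forall g h (gh : composable g h), A g -> A h -> A (gcomp gh))
    (Ai : forall g, A g -> A (ginv g))
    (Bc : forall g h (gh : composable g h), B g -> B h -> B (gcomp gh))
    (Bi : forall g, B g -> B (ginv g)) :
  groupoid_iso f -> (forall g, A g <-> B (f g)) ->
  exists phi : subgroupoid Ac Ai -> subgroupoid Bc Bi,
    (forall g, set_val (phi g) = f (set_val g)) /\ groupoid_iso phi.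
Proof.
move=> [fh fcomposable fcomp finv] AB.
exists (@set_type_map _ _ _ _ f (fun g => proj1 (AB g))); split=> //; split.
- by apply: homeomorphism_set_type_map => // g /AB.
- by move=> g h; exact: fcomposable.
- by move=> g h gh fgh; apply: val_inj; exact: fcomp.
- by move=> g; apply: val_inj; exact: finv.
Qed.

Section Conjugacy.
Context (X Y : topologicalType) (P : monoidType).
Context (TX : monoid_action X P) (TY : monoid_action Y P) (h : X -> Y).
Hypothesis hconj : conjugacy TX TY h.

(** Condition (C2) equates sets; injectivity of [h] turns it into a pointwise equivalence. *)
Lemma conjugacy_dom m x : dom TY m (h x) <-> dom TX m x.
Proof.
have [[k [hK _ _ _]] hd _] := hconj; rewrite -hd.
by split=> [[x' dx' /(can_inj hK) <-]|dx] //; exists x.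
Qed.

Lemma conjugacy_act m x : dom TX m x -> act TY (h x) m = h (act TX x m).
Proof. by have [_ _ ha] := hconj => /ha. Qed.

Lemma conjugacy_act_eq m n x y : dom TX m x -> dom TX n y ->
  act TY (h x) m = act TY (h y) n <-> act TX x m = act TX y n.
Proof.
move=> dx dy; rewrite !conjugacy_act //; have [[k [hK _ _ _]] _ _] := hconj.
by split=> [/(can_inj hK)|->].
Qed.

Lemma conjugacy_act_invariant (U : set X) :
  act_invariant TX U -> act_invariant TY (h @` U).
Proof.
have [[k [_ kK _ _]] _ _] := hconj.
(* Writing [x] as [h (k x)] pulls the equation back to [k x] and [y] in [X], where invariance of [U]
   applies. *)
move=> iU x _ m n [y Uy <-]; rewrite -[x]kK !conjugacy_dom => dx dy.
by move=> /(conjugacy_act_eq dx dy) e; exists (k x); first exact: iU e.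
Qed.

End Conjugacy.

Lemma conjugacy_inverse (X Y : topologicalType) (P : monoidType)
    (TX : monoid_action X P) (TY : monoid_action Y P) (h : X -> Y)
    (k : Y -> X) :
  conjugacy TX TY h -> cancel h k -> cancel k h -> continuous k ->
  conjugacy TY TX k.
Proof.
move=> hconj hK kK kc; have [[_ [_ _ hc _]] hd _] := hconj; split.
- by exists h.
- move=> m; rewrite -hd image_comp.
  by apply/seteqP; split=> [_ [x dx <-]|x dx]; [rewrite /= hK|exists x => //=].
(* Only the occurrences of [y] in the domain and under [act TY] become [h (k y)]; then (C3) for [h]
   at [k y] applies. *)
- move=> m y; rewrite -{1 2}[y]kK => /(conjugacy_dom hconj) dy.
  by rewrite (conjugacy_act hconj) // hK.
Qed.

Section SemidirectMap.
Context (Q : groupType) (S : pred Q) (P : subMonoidType S).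
Context (X Y : topologicalType).
Context (TX : monoid_action X P) (TY : monoid_action Y P).
Context (dX : directed TX) (lX : locally_compact_action TX).
Context (dY : directed TY) (lY : locally_compact_action TY).
Context (h : X -> Y) (hconj : conjugacy TX TY h).

Let GX := semidirect_groupoid dX lX.
Let GY := semidirect_groupoid dY lY.

Let conj_map (g : X * Q * X) : Y * Q * Y := (h g.1.1, g.1.2, h g.2).

Lemma sdp_set_conjugacy g : sdp_set TX g -> sdp_set TY (conj_map g).
Proof.
move=> [m [n [dg dm dn e]]]; exists m, n.
by split=> //; [apply/(conjugacy_dom hconj)..|apply/(conjugacy_act_eq hconj)].
Qed.

Definition sdp_map : GX -> GY := set_type_map sdp_set_conjugacy.

(** The preimage form yields continuity at once, and with images under [h] for [U] and [V] also the
    formula for the image of a basic set. *)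
Lemma sdp_Z_map (U V : set Y) m n (g : GX) :
  sdp_Z U m n V (sdp_map g) <-> sdp_Z (h @^-1` U) m n (h @^-1` V) g.
Proof.
split=> -[dg Ug Vg [dm dn e]]; split=> //.
  have {}dm := proj1 (conjugacy_dom hconj _ _) dm.
  have {}dn := proj1 (conjugacy_dom hconj _ _) dn.
  by split=> //; apply/(conjugacy_act_eq hconj).
by split; [apply/(conjugacy_dom hconj)..|apply/(conjugacy_act_eq hconj)].
Qed.

Lemma sdp_map_continuous : continuous sdp_map.
Proof.
have [[_ [_ _ /continuousP hc _]] _ _] := hconj.
move=> g A /sdp_nbhsP[U [m [n [V [oU oV Zg ZA]]]]]; rewrite nbhs_filterE.
suff : nbhs g (sdp_Z (h @^-1` U) m n (h @^-1` V) : set GX).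
  by apply: (@filterS _ _ (nbhs_filter g)) => k /sdp_Z_map/ZA.
apply: open_nbhs_nbhs; split; last exact/sdp_Z_map.
by apply: sdp_Z_open; exact: hc.
Qed.

End SemidirectMap.

Lemma sdp_map_cancel (Q : groupType) (S : pred Q) (P : subMonoidType S)
    (X Y : topologicalType) (TX : monoid_action X P) (TY : monoid_action Y P)
    (dX : directed TX) (lX : locally_compact_action TX)
    (dY : directed TY) (lY : locally_compact_action TY)
    (h : X -> Y) (k : Y -> X)
    (hconj : conjugacy TX TY h) (kconj : conjugacy TY TX k) :
  cancel h k ->
  cancel (sdp_map dY lY hconj : semidirect_groupoid dX lX -> _)
         (sdp_map dX lX kconj).
Proof. by move=> hK g; apply: sdp_eq => //; exact: hK. Qed.

Theorem theorem3p3 (Q : groupType) (S : pred Q) (P : subMonoidType S)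
    (X Y : topologicalType) (TX : monoid_action X P) (TY : monoid_action Y P)
    (dX : directed TX) (lX : locally_compact_action TX)
    (dY : directed TY) (lY : locally_compact_action TY) (h : X -> Y)
    (hconj : conjugacy TX TY h) :
  exists psi : semidirect_groupoid dX lX -> semidirect_groupoid dY lY,
    (forall g, sdp_val (psi g) = (h (sdp_lft g), sdp_deg g, h (sdp_rgt g))) /\
    groupoid_iso psi /\
    (forall (U V : set X) (m n : P), open U -> open V ->
       psi @` sdp_Z U m n V = sdp_Z (h @` U) m n (h @` V)) /\
    (forall U : set X, closed U -> act_invariant TX U ->
       closed (h @` U) /\ act_invariant TY (h @` U) /\
       exists phi : reduction dX lX U -> reduction dY lY (h @` U),
         (forall g, set_val (phi g) = psi (set_val g)) /\ groupoid_iso phi).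
Proof.
have [hhom _ _] := hconj; have [k [hK kK hc kc]] := hhom.
have kconj := conjugacy_inverse hconj hK kK kc.
pose psi : semidirect_groupoid dX lX -> _ := sdp_map dY lY hconj.
pose psi' : semidirect_groupoid dY lY -> _ := sdp_map dX lX kconj.
have psiK : cancel psi psi' by exact: sdp_map_cancel.
have psi'K : cancel psi' psi by exact: sdp_map_cancel.
(* Injectivity of [h] lets the preimages in [sdp_Z_map] collapse when the sets are images. *)
have hU (U : set X) : h @^-1` (h @` U) = U.
  apply/seteqP; split=> [x [y Uy /(can_inj hK) <-] //|x Ux].
  by exists x.
have psi_iso : groupoid_iso psi.
  split.
  - by exists psi'; split=> //; exact: sdp_map_continuous.
  (* Composability is the equation of the inner endpoints, which the injective [h] preserves and
     reflects. *)
  - move=> g g'; split=> [|e]; first by move/(can_inj hK).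
    exact: (congr1 h e).
  - by move=> g g' gg' fgg'; apply: sdp_eq.
  - by move=> g; apply: sdp_eq.
exists psi; split=> //; split=> //; split.
  move=> U V m n _ _; apply/seteqP; split=> [_ [g Zg <-]|g].
    by apply/sdp_Z_map; rewrite !hU.
  (* The preimage of [g] is [psi' g], and it lies in the basic set by [sdp_Z_map]. *)
  by rewrite -[g]psi'K => /sdp_Z_map; rewrite !hU => Zg; exists (psi' g).
move=> U cU iU; split; first exact: homeomorphism_closed_image.
split; first exact: conjugacy_act_invariant iU.
apply: subgroupoid_iso => // g.
rewrite -{1}(hU U); split; exact.
Qed.
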